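(* (i) The dual automaton of the Aleshin automaton $A$ defines a group that acts transitively on each level of the rooted ternary tree $\{a,b,c\}^*$. (ii) For any $n\ge1$ the dual automaton of the Aleshin type automaton $A^{(n)}$ defines a group that acts transitively on each level of the rooted $(2n+1)$-regular tree $Q_n^*$, where $Q_n$ is the set of internal states of $A^{(n)}$.
   Context: An automaton is a quadruple $(Q,X,\phi,\psi)$ with nonempty sets $Q$ (internal states) and $X$ (finite alphabet), a state transition function $\phi:Q\times X\to Q$ and an output function $\psi:Q\times X\to X$. $X^*$ is the set of finite words over $X$ (including the empty word), viewed as a rooted tree; its $k$-th level ($k\ge0$) is the set of words of length $k$. For an automaton $Y=(Q,X,\phi,\psi)$ and $q\in Q$, the transformation $Y_q:X^*\to X^*$ is defined recursively by $Y_q(\varnothing)=\varnothing$ and $Y_q(xw)=\psi(q,x)\,Y_{\phi(q,x)}(w)$ for $x\in X$, $w\in X^*$. $Y$ is invertible if all $Y_q$ are bijective; then the group defined by $Y$ is the group of transformations of $X^*$ generated (under composition) by $Y_q$, $q\in Q$. The dual automaton of a finite automaton $(Q,X,\phi,\psi)$ is the automaton $(X,Q,\tilde\phi,\tilde\psi)$ with state set $X$ and alphabet $Q$, where $\tilde\phi(x,q)=\psi(q,x)$ and $\tilde\psi(x,q)=\phi(q,x)$. Aleshin type automata: for $n\ge1$, $A^{(n)}=(Q_n,\{0,1\},\phi_n,\psi_n)$, where $Q_1=\{a_1,b_1,c_1\}$ and $Q_n=\{a_n,b_n,c_n,q_{n1},\dots,q_{n,2n-2}\}$ for $n\ge2$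 (a set of $2n+1$ elements). With $q_{n0}:=c_n$ and $q_{n,2n-1}:=a_n$: $\phi_n(a_n,0)=\phi_n(b_n,1)=c_n$, $\phi_n(a_n,1)=\phi_n(b_n,0)=b_n$, and $\phi_n(q_{ni},0)=\phi_n(q_{ni},1)=q_{n,i+1}$ for $0\le i\le 2n-2$. For $x\in\{0,1\}$: $\psi_n(q,x)=1-x$ if $q\in\{a_n,b_n\}$, and $\psi_n(q,x)=x$ if $q\in Q_n\setminus\{a_n,b_n\}$. The Aleshin automaton $A$ is $A^{(1)}$ with states $a_1,b_1,c_1$ renamed $a,b,c$. The dual automata of $A$ and $A^{(n)}$ are invertible. *)

(* Defs.v *)
From HB Require Import structures.
From mathcomp Require Import all_boot.

Set Implicit Arguments.
Unset Strict Implicit.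
Unset Printing Implicit Defensive.

Record automaton (Q : Type) (X : finType) := Automaton {
  trans : Q -> X -> Q;
  out : Q -> X -> X;
  states_nonempty : inhabited Q;
  alphabet_nonempty : inhabited X
}.

Fixpoint transformation (Q : Type) (X : finType) (Y : automaton Q X)
    (q : Q) (w : seq X) : seq X :=
  if w is x :: w' then out Y q x :: transformation Y (trans Y q x) w'
  else [::].

Definition invertible (Q : Type) (X : finType) (Y : automaton Q X) : Prop :=
  forall q, bijective (transformation Y q).

(* Closure under inverses is expressed relationally (any two-sided inverse of
   a member is a member), so no choice of inverse function is needed; it also
   makes the predicate invariant under pointwise equality of functions. *)
Inductive generated (T : Type) (S : (T -> T) -> Prop) : (T -> T) -> Prop :=
| generated_gen g of S g : generated S g
| generated_id : generated S id
| generated_comp g h of generated S g & generated S h : generated S (g \o h)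
| generated_inv g h of generated S g & cancel g h & cancel h g :
    generated S h.

Definition automaton_group (Q : Type) (X : finType) (Y : automaton Q X) :
    (seq X -> seq X) -> Prop :=
  generated (fun g => exists q, g = transformation Y q).

Definition transitive_on_level (X : Type) (G : (seq X -> seq X) -> Prop)
    (k : nat) : Prop :=
  forall u v : seq X, size u = k -> size v = k -> exists2 g, G g & g u = v.

Definition dual (Q X : finType) (Y : automaton Q X) : automaton X Q :=
  {| trans := fun x q => out Y q x;
     out := fun x q => trans Y q x;
     states_nonempty := alphabet_nonempty Y;
     alphabet_nonempty := states_nonempty Y |}.

(* [Sq i] is q_{n,i+1}: the ordinal is 0-based, the subscripts start at 1.
   The binary alphabet {0,1} is [bool], with 0 = [false] and 1 = [true]. *)
Inductive astate (n : nat) : Type :=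
  Sa | Sb | Sc | Sq of 'I_(2 * n - 2).

Arguments Sa {n}.
Arguments Sb {n}.
Arguments Sc {n}.

Definition astate_code n (s : astate n) : option (option (option 'I_(2 * n - 2))) :=
  match s with
  | Sa => None
  | Sb => Some None
  | Sc => Some (Some None)
  | Sq i => Some (Some (Some i))
  end.

Definition astate_decode n (c : option (option (option 'I_(2 * n - 2)))) : astate n :=
  match c with
  | None => Sa
  | Some None => Sb
  | Some (Some None) => Sc
  | Some (Some (Some i)) => Sq i
  end.

Lemma astate_codeK n : cancel (@astate_code n) (@astate_decode n).
Proof. by case. Qed.

HB.instance Definition _ n := Finite.copy (astate n) (can_type (@astate_codeK n)).

Lemma card_astate n : 0 < n -> #|{: astate n}| = 2 * n + 1.
Proof.
move=> n_gt0; rewrite (bij_eq_card (f := @astate_code n)).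
  by rewrite !card_option card_ord; case: n n_gt0 => // n _; rewrite mulnS addn1 addKn.
by exists (@astate_decode n); [exact: astate_codeK | case=> [[[]|]|]].
Qed.

(* The state q_{n,i} for 0 <= i <= 2n-1, with the conventions q_{n,0} = c_n and
   q_{n,2n-1} = a_n; larger i give the junk value a_n. *)
Definition qstate n (i : nat) : astate n :=
  if i is j.+1 then oapp (@Sq n) Sa (insub j) else Sc.

Definition aleshin_type_trans n (s : astate n) (x : bool) : astate n :=
  match s with
  | Sa => if x then Sb else Sc
  | Sb => if x then Sc else Sb
  | Sc => qstate n 1
  | Sq i => qstate n i.+2
  end.

Definition aleshin_type_out n (s : astate n) (x : bool) : bool :=
  match s with
  | Sa | Sb => ~~ x
  | Sc | Sq _ => x
  end.

Definition aleshin_type n : automaton (astate n) bool :=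
  {| trans := @aleshin_type_trans n;
     out := @aleshin_type_out n;
     states_nonempty := inhabits Sa;
     alphabet_nonempty := inhabits false |}.

Lemma qstate_last n : 0 < n -> qstate n (2 * n - 1) = Sa.
Proof.
case: n => // n _; have -> : 2 * n.+1 - 1 = (2 * n.+1 - 2).+1 by rewrite mulnS add2n subn1 subn2.
by rewrite /= insubN ?ltnn.
Qed.

Lemma trans_qstate n i x : i <= 2 * n - 2 ->
  trans (aleshin_type n) (qstate n i) x = qstate n i.+1.
Proof. by case: i => [|i] //= lt_i; rewrite insubT. Qed.

Inductive abc : Type := state_a | state_b | state_c.

Definition abc_code (s : abc) : option bool :=
  match s with state_a => None | state_b => Some false | state_c => Some true end.

Definition abc_decode (o : option bool) : abc :=
  match o with None => state_a | Some false => state_b | Some true => state_c end.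

Lemma abc_codeK : cancel abc_code abc_decode.
Proof. by case. Qed.

HB.instance Definition _ := Finite.copy abc (can_type abc_codeK).

Definition aleshin_trans (s : abc) (x : bool) : abc :=
  match s with
  | state_a => if x then state_b else state_c
  | state_b => if x then state_c else state_b
  | state_c => state_a
  end.

Definition aleshin_out (s : abc) (x : bool) : bool :=
  match s with state_a | state_b => ~~ x | state_c => x end.

Definition aleshin : automaton abc bool :=
  {| trans := aleshin_trans;
     out := aleshin_out;
     states_nonempty := inhabits state_a;
     alphabet_nonempty := inhabits false |}.

Definition abc_rename (s : abc) : astate 1 :=
  match s with state_a => Sa | state_b => Sb | state_c => Sc end.

Lemma abc_rename_bij : bijective abc_rename.
Proof.
exists (fun s : astate 1 => match s with Sb => state_b | Sc => state_c | _ => state_a end).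
  by case.
by case=> // -[].
Qed.

Lemma aleshin_rename s x :
  trans (aleshin_type 1) (abc_rename s) x = abc_rename (trans aleshin s x)
  /\ out (aleshin_type 1) (abc_rename s) x = out aleshin s x.
Proof. by case: s x => -[]; split=> //=; rewrite insubN. Qed.

(* Main.v *)
Require Import Defs.
From mathcomp Require Import all_boot.

(* Write a, b, c, q_i for the states, N = 2n+1 for their number, and D_0, D_1 for
   the generators of the dual group.  D_1 D_0^-1 acts letterwise as (b c) and
   D_0^-1 D_1 acts letterwise as (a b), so the group contains all letterwise
   permutations of {a, b, c}.  The element e = (a c) D_0^(2n-1) fixes each c^k;
   together with (a b) it shows that the words c^k x, x <> c, are all in one
   orbit.  It also fixes b c^(k-1), and acts on the letter following that word
   with c as its only fixed point.  Assume transitivity on level k >= 1 and let O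
   be the orbit of c^(k+1).  If O is not the whole level, then each word of length
   k has exactly one extension in O, so |O| = N^k.  The dual automaton being
   bireversible, the projection of O onto suffixes of length k is onto, hence
   injective.  But the extension of b c^(k-1) must be b c^k, which has the same
   suffix as c^(k+1). *)

Set Implicit Arguments.
Unset Strict Implicit.
Unset Printing Implicit Defensive.

(** * Orbits of groups generated by invertible automata *)

Lemma automaton_group_bij (Q : Type) (X : finType) (Y : automaton Q X) g :
  invertible Y -> automaton_group Y g -> bijective g.
Proof.
move=> invY; elim=> [_ [q ->]||g1 g2 _ bij1 _ bij2|g1 h _ _ gK hK].
- exact: invY.
- by exists id.
- exact: bij_comp.
- by exists g1.
Qed.

Section AutomatonGroup.

Variables (Q : Type) (X : finType) (Y : automaton Q X).
Hypothesis out_inj : forall q, injective (out Y q).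

(** State [q] computes the inverse of [transformation Y q]: it recovers the input letter from the
    output letter and moves as [Y] does on it. *)
Definition inverse_automaton : automaton Q X :=
  {| trans := fun q x => trans Y q (invF (@out_inj q) x);
     out := fun q => invF (@out_inj q);
     states_nonempty := states_nonempty Y;
     alphabet_nonempty := alphabet_nonempty Y |}.

Lemma out_inj_invertible : invertible Y.
Proof.
move=> q; exists (transformation inverse_automaton q) => w.
  by elim: w q => //= x w IHw q; rewrite invF_f IHw.
by elim: w q => //= x w IHw q; rewrite f_invF IHw.
Qed.

Definition same_orbit (u v : seq X) : Prop :=
  exists2 g, automaton_group Y g & g u = v.

Lemma same_orbit_refl u : same_orbit u u.
Proof. by exists id => //; apply: generated_id. Qed.

Lemma same_orbit_trans v u w :
  same_orbit u v -> same_orbit v w -> same_orbit u w.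
Proof.
by case=> g Gg <- [h Gh <-]; exists (h \o g) => //; apply: generated_comp.
Qed.

Lemma same_orbit_sym u v : same_orbit u v -> same_orbit v u.
Proof.
case=> g Gg <-; have [h gK hK] := automaton_group_bij out_inj_invertible Gg.
by exists h => //; apply: generated_inv Gg gK hK.
Qed.

Lemma same_orbit_transformation q u : same_orbit u (transformation Y q u).
Proof. by exists (transformation Y q) => //; apply: generated_gen; exists q. Qed.

(** [s] is the output function of the state reached from [q] after reading [w]. *)
Lemma transformation_rcons q w : exists2 s : X -> X, injective s &
  forall x, transformation Y q (rcons w x) = rcons (transformation Y q w) (s x).
Proof.
elim: w q => [|y w IHw] q /=; first by exists (out Y q).
by have [s inj_s sE] := IHw (trans Y q y); exists s => // x; rewrite sE.
Qed.

Lemma automaton_group_rcons g : automaton_group Y g -> forall w,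
  exists2 s : X -> X, injective s & forall x, g (rcons w x) = rcons (g w) (s x).
Proof.
elim=> [_ [q ->]||g1 g2 _ IH1 _ IH2|g1 h _ IHg gK hK] w.
- exact: transformation_rcons.
- by exists id.
- have [s2 inj2 s2E] := IH2 w; have [s1 inj1 s1E] := IH1 (g2 w).
  by exists (s1 \o s2) => [|x] /=; [apply: inj_comp | rewrite s2E s1E].
- have [s inj_s sE] := IHg (h w); exists (invF inj_s).
    exact: (can_inj (f_invF inj_s)).
  by move=> x; apply: (can_inj gK); rewrite hK sE hK f_invF.
Qed.

(** * From level k to level k+1 for bireversible automata *)

Hypothesis bireversible :
  forall x q, exists y p, out Y p y = x /\ trans Y p y = q.
Hypothesis trans_surj : forall x q, exists p, trans Y p x = q.

(** A generator [Y_q] acts below a first letter through any state that this letter leads to [q].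
    Such a state comes from [trans_surj] for a given input letter, and from [bireversible] for a
    given output letter, as inverses require. *)
Lemma same_orbit_behead u v x :
  same_orbit u v -> exists y, same_orbit (x :: u) (y :: v).
Proof.
(* Both directions are proved at once, because passing to an inverse exchanges them. *)
have main g : automaton_group Y g -> forall w y,
    (exists z, same_orbit (y :: w) (z :: g w)) /\
    (exists z, same_orbit (y :: g w) (z :: w)).
  elim=> [_ [q ->] w y||g1 g2 _ IH1 _ IH2 w y|g1 h _ IHg gK hK w y].
  - split.
      have [p pE] := trans_surj y q; exists (out Y p y); rewrite -pE.
      exact: same_orbit_transformation.
    have [z [p [<- <-]]] := bireversible y q; exists z.
    exact/same_orbit_sym/(same_orbit_transformation p (z :: w)).
  - by move=> w y; split; exists y; apply: same_orbit_refl.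
  - split=> /=.
      have [[z yz] _] := IH2 w y; have [[t zt] _] := IH1 (g2 w) z.
      by exists t; apply: same_orbit_trans yz zt.
    have [_ [z yz]] := IH1 (g2 w) y; have [_ [t zt]] := IH2 w z.
    by exists t; apply: same_orbit_trans yz zt.
  - by have [] := IHg (h w) y; rewrite hK.
by case=> g Gg <-; have [] := main g Gg u x.
Qed.

Lemma transitive_on_next_level (k : nat) (b c : X) (w0 w1 : seq X) :
    transitive_on_level (automaton_group Y) k ->
    size w0 = k -> size w1 = k -> w0 <> w1 ->
    behead (rcons w0 c) = behead (rcons w1 c) ->
    (forall x, x != c -> same_orbit (rcons w0 x) (rcons w0 b)) ->
    (forall x, x != c -> exists2 y, y != x &
       same_orbit (rcons w1 x) (rcons w1 y)) ->
  transitive_on_level (automaton_group Y) k.+1.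
Proof.
move=> trk sz0 sz1 neq01 eq01 orb0 orb1.
pose O := same_orbit (rcons w0 c).
have O_trans u v : O u -> same_orbit u v -> O v by apply: same_orbit_trans.
(* Moving [w] to [w0] keeps the two last letters distinct, so one of them is not [c], and [orb0]
   takes it to [b]. *)
have two w x y : size w = k -> x != y -> O (rcons w x) -> O (rcons w y) ->
    O (rcons w0 b).
  move=> szw neq_xy Ox Oy; have [g Gg gw] := trk w w0 szw sz0.
  have [s inj_s sE] := automaton_group_rcons Gg w.
  have Os z : O (rcons w z) -> O (rcons w0 (s z)).
    by move=> Oz; apply: O_trans Oz _; exists g; rewrite // sE gw.
  have [sxc|/orb0] := eqVneq (s x) c; last by apply/O_trans/Os.
  apply: O_trans (Os _ Oy) (orb0 _ _).
  by rewrite -sxc (inj_eq inj_s) eq_sym.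
have ext w : size w = k -> exists x, O (rcons w x).
  move=> szw; have [g Gg gw] := trk w0 w sz0 szw.
  have [s _ sE] := automaton_group_rcons Gg w0.
  by exists (s c); exists g; rewrite // sE gw.
suffices Ob : O (rcons w0 b).
  have all_O u : size u = k.+1 -> O u.
    case/lastP: u => // w x; rewrite size_rcons => -[szw].
    have [g Gg gw] := trk w w0 szw sz0.
    have [s _ sE] := automaton_group_rcons Gg w.
    have ux : same_orbit (rcons w x) (rcons w0 (s x)) by exists g; rewrite // sE gw.
    apply: (O_trans (rcons w0 (s x))); last exact: same_orbit_sym.
    have [->|/orb0/same_orbit_sym] := eqVneq (s x) c; first exact: same_orbit_refl.
    exact: O_trans Ob.
  move=> u v szu szv; apply: same_orbit_trans (all_O v szv).
  exact/same_orbit_sym/all_O.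
have [f fO] : exists f : k.-tuple X -> X, forall w : k.-tuple X, O (rcons w (f w)).
  exact: (fin_all_exists (fun w : k.-tuple X => ext w (size_tuple w))).
(* [F] sends [w] to the suffix of length k of the chosen word [w (f w)] of [O]. *)
pose F (w : k.-tuple X) : k.-tuple X := [tuple of behead (rcons_tuple w (f w))].
have [/injectiveP injF|notinj] := boolP (injectiveb F).
  pose t0 : k.-tuple X := Tuple (introT eqP sz0).
  pose t1 : k.-tuple X := Tuple (introT eqP sz1).
  (* Unless both chosen letters are [c], [orb0], or [orb1] together with [two], already gives
     [w0 b]. *)
  have [f0|/orb0] := eqVneq (f t0) c; last by apply: O_trans (fO t0).
  have [f1|/orb1[y neq_y orb_y]] := eqVneq (f t1) c; last first.
    by apply: (two w1 y (f t1)) => //; [apply: O_trans (fO t1) orb_y | apply: fO t1].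
  case: neq01; rewrite -[w0]/(val t0) -[w1]/(val t1); congr val.
  by apply/injF/val_inj; rewrite /= f0 f1.
(* On a finite set, a map that is not injective misses some [v]. *)
have /forallPn[v /negP vF] : ~~ [forall v, v \in codom F].
  apply: contra notinj => /forallP surjF; apply/injectiveP.
  suffices injF: {in {: k.-tuple X} &, injective F} by move=> w w'; apply: injF.
  by apply/image_injP/eqP/eq_card.
(* Some word of [O] still has suffix [v]: carry the suffix of [w0 c] to [v], then restore a first
   letter. *)
have [x Ox] : exists x, O (x :: v).
  case def_u: (rcons w0 c) => [|y u]; first by case: (w0) def_u.
  have szu : size u = k by move/(congr1 size): def_u; rewrite size_rcons sz0 => -[].
  have [g Gg gu] := trk u v szu (size_tuple v).
  rewrite /O def_u; apply: same_orbit_behead; by exists g.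
case/lastP def_u: (x :: v : seq X) Ox => [|w y] // Ow.
have /eqP szw : size w == k.
  by move/(congr1 size): def_u; rewrite size_rcons /= size_tuple => -[->].
pose t : k.-tuple X := Tuple (introT eqP szw).
(* If [y] were [f t], then [v] would be in the image of [F]; hence [w] has two extensions in [O]. *)
apply: (two w (f t) y) => //; last exact: fO t.
apply: contra_notN vF => /eqP fy; apply/codomP; exists t.
by apply: val_inj; rewrite /= fy -def_u.
Qed.

End AutomatonGroup.

(** * Renaming the letters of the alphabet *)

(** Each element of the group of [Y'] is matched through [map f] by one of the group of [Y]. This
    carries the result for A^(1) over to A. *)
Lemma transitive_on_level_rename (Q : Type) (X X' : finType)
    (Y : automaton Q X) (Y' : automaton Q X') (f : X -> X') (k : nat) :
    (forall q x, out Y' q (f x) = f (out Y q x)) ->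
    (forall q x, trans Y' q (f x) = trans Y q x) ->
    bijective f -> invertible Y ->
    transitive_on_level (automaton_group Y') k ->
  transitive_on_level (automaton_group Y) k.
Proof.
move=> outE transE [f' fK f'K] invY trY'.
have pull g' : automaton_group Y' g' ->
    exists2 g, automaton_group Y g & forall w, map f (g w) = g' (map f w).
  elim=> [_ [q ->]||g1 g2 _ [h1 Gh1 h1E] _ [h2 Gh2 h2E]|g1 h _ [h1 Gh1 h1E] gK hK].
  - exists (transformation Y q); first by apply: generated_gen; exists q.
    by move=> w; elim: w q => //= x w IHw q; rewrite outE transE IHw.
  - by exists id => //; apply: generated_id.
  - exists (h1 \o h2); first exact: generated_comp.
    by move=> w; rewrite /= h1E h2E.
  - have [h2 h1K h2K] := automaton_group_bij invY Gh1.
    exists h2; first exact: generated_inv Gh1 h1K h2K.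
    by move=> w; apply: (can_inj gK); rewrite hK -h1E h2K.
move=> u v szu szv.
have [g' Gg' g'u] := trY' (map f u) (map f v) (etrans (size_map _ _) szu)
  (etrans (size_map _ _) szv).
have [g Gg gE] := pull _ Gg'; exists g => //.
by apply: (inj_map (can_inj fK)); rewrite gE.
Qed.

(** * Transitions of Aleshin type automata and bireversibility of their duals *)

Section AleshinType.

Variable n : nat.
Hypothesis n_gt0 : 0 < n.

Local Notation Y := (aleshin_type n).
Local Notation Z := (dual Y).
Local Notation D := (transformation Z).
Local Notation step p := (fun q => trans Y q p).
Local Notation orbit := (same_orbit Z).

Lemma state_cases (q : astate n) :
  q = Sb \/ exists2 i, i <= 2 * n - 1 & q = qstate n i.
Proof.
case: q => [| | |i]; [right|by left|right|right].
- by exists (2 * n - 1) => //; rewrite qstate_last.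
- by exists 0.
- exists i.+1; last by rewrite /= valK.
  exact: leq_trans (ltn_ord i) (leq_sub2l _ _).
Qed.

Lemma out_qstate i p : i <= 2 * n - 2 -> out Y (qstate n i) p = p.
Proof. by case: i => [|i] //= lt_i; rewrite insubT. Qed.

Lemma lt_last_index i : i < 2 * n - 1 -> i <= 2 * n - 2.
Proof. by case: (2 * n) => [|[|m]]; rewrite ?subn1 ?subn2. Qed.

Lemma last_index_gt0 : 0 < 2 * n - 1.
Proof. by case: n n_gt0 => // m _; rewrite mulnS add2n subn1. Qed.

Lemma iter_step i m p : i + m <= 2 * n - 1 ->
  iter m (step p) (qstate n i) = qstate n (i + m).
Proof.
elim: m => [|m IHm]; first by rewrite addn0.
rewrite addnS => lt_im; rewrite iterS IHm ?(ltnW lt_im) //.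
exact/trans_qstate/lt_last_index.
Qed.

Lemma iter_step_Sa i p : i <= 2 * n - 1 ->
  iter (2 * n - 1 - i) (step p) (qstate n i) = Sa.
Proof. by move=> le_i; rewrite iter_step subnKC // qstate_last. Qed.

(** The first claim makes the outputs of the dual injective, the second makes the dual bireversible.
    Each of b and c is entered from a and from b, with different letters and outputs; every other
    state is entered from its predecessor in the chain, which copies the letter. *)
Lemma predecessor (q : astate n) (p : bool) :
  (exists q', trans Y q' p = q) /\
  (exists q' p', trans Y q' p' = q /\ out Y q' p' = p).
Proof.
have [->|[[|i] le_i ->]] := state_cases q.
- by case: p; split; [exists Sa | exists Sb, false | exists Sb | exists Sa, true].
- by case: p; split; [exists Sb | exists Sa, false | exists Sa | exists Sb, true].
- split; [exists (qstate n i) | exists (qstate n i), p].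
    exact/trans_qstate/lt_last_index.
  by rewrite trans_qstate ?out_qstate ?lt_last_index.
Qed.

Lemma step_inj p : injective (step p).
Proof.
have [g gK] : exists g, forall q, trans Y (g q) p = q.
  exact: (fin_all_exists (fun q => proj1 (predecessor q p))).
exact/can_inj/canF_sym/gK.
Qed.

Lemma dual_out_inj p : injective (out Z p).
Proof. exact: step_inj. Qed.

Lemma dual_invertible : invertible Z.
Proof. exact/out_inj_invertible/dual_out_inj. Qed.

Lemma dual_bireversible q p : exists q' p', out Z p' q' = q /\ trans Z p' q' = p.
Proof. by have [_ [q' [p' [? ?]]]] := predecessor q p; exists q', p'. Qed.

Lemma dual_trans_surj q p : exists p', trans Z p' q = p.
Proof.
by case: q => [| | |i]; [exists (~~ p) | exists (~~ p) | exists p | exists p];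
   rewrite /= ?negbK.
Qed.

(** * Letterwise permutations of a, b, c in the dual group *)

Definition swap_ab (q : astate n) : astate n :=
  match q with Sa => Sb | Sb => Sa | _ => q end.

Definition swap_bc (q : astate n) : astate n :=
  match q with Sb => Sc | Sc => Sb | _ => q end.

Definition swap_ac (q : astate n) : astate n :=
  match q with Sa => Sc | Sc => Sa | _ => q end.

Lemma swap_bc_qstate i : swap_bc (qstate n i.+1) = qstate n i.+1.
Proof. by rewrite /=; case: insub. Qed.

(** The moves of a state on 0 and on 1 differ by (b c), and every output function commutes with
    negation, so a flipped dual state stays flipped along the word. *)
Lemma dual_transformationN p u : D (~~ p) u = map swap_bc (D p u).
Proof.
elim: u p => //= q u IHu p; congr cons.
  by case: q => [| | |i]; rewrite /= -?[oapp _ _ _]/(qstate n _.+1) ?swap_bc_qstate //; case: p.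
by rewrite -IHu; case: q.
Qed.

(** a moves on x as b does on 1 - x, and both negate; the moves of all other states ignore the
    letter. *)
Lemma dual_transformation_swap_ab p u : D p (map swap_ab u) = D (~~ p) u.
Proof.
elim: u p => //= q u IHu p; rewrite IHu; congr cons; first by case: q p => [| | |i] [].
by case: q.
Qed.

Lemma orbit_refl u : orbit u u. Proof. exact: same_orbit_refl. Qed.

Lemma orbit_trans v u w : orbit u v -> orbit v w -> orbit u w.
Proof. exact: same_orbit_trans. Qed.

Lemma orbit_sym u v : orbit u v -> orbit v u.
Proof. exact/same_orbit_sym/dual_out_inj. Qed.

Lemma orbit_dual p u : orbit u (D p u).
Proof. exact: same_orbit_transformation. Qed.

Lemma orbit_swap_ab u : orbit u (map swap_ab u).
Proof.
apply: orbit_trans (orbit_dual true u) _; apply: orbit_sym.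
by rewrite -[true]/(~~ false) -dual_transformation_swap_ab; apply: orbit_dual.
Qed.

Lemma orbit_swap_bc u : orbit u (map swap_bc u).
Proof.
have [g _ gK] := dual_invertible false.
rewrite -[u]gK -dual_transformationN.
exact: orbit_trans (orbit_sym (orbit_dual _ _)) (orbit_dual _ _).
Qed.

Lemma orbit_swap_ac u : orbit u (map swap_ac u).
Proof.
have -> : map swap_ac u = map swap_bc (map swap_ab (map swap_bc u)).
  by rewrite -!map_comp; apply: eq_map; case.
apply: orbit_trans (orbit_swap_bc _) _; apply: orbit_trans (orbit_swap_ab _) _.
exact: orbit_swap_bc.
Qed.

(** * One-letter extensions of c^k and b c^k *)

(** Such a q_i copies its letter, so the dual state is still [p] when it meets [x]. *)
Lemma dual_transformation_nseq k i x p : i <= 2 * n - 2 ->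
  D p (rcons (nseq k (qstate n i)) x) =
    rcons (nseq k (qstate n i.+1)) (trans Y x p).
Proof.
move=> le_i; elim: k => //= k IHk; congr cons; first exact: trans_qstate.
by rewrite [aleshin_type_out _ _]out_qstate.
Qed.

Lemma orbit_nseq_Sa k x :
  orbit (rcons (nseq k Sc) x)
        (rcons (nseq k Sa) (iter (2 * n - 1) (step false) x)).
Proof.
rewrite -(qstate_last n_gt0); elim: {-2}(2 * n - 1) (leqnn (2 * n - 1)) => [|i IHi] le_i.
  exact: orbit_refl.
apply: orbit_trans (IHi (ltnW le_i)) _.
by rewrite iterS -dual_transformation_nseq ?lt_last_index //; apply: orbit_dual.
Qed.

(** D_0 keeps the leading b, which turns the dual state into 1; the rest of the word is thus acted
    on by D_1. *)
Lemma orbit_Sb_nseq_Sa k x :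
  orbit (Sb :: rcons (nseq k Sc) x)
        (Sb :: rcons (nseq k Sa) (iter (2 * n - 1) (step true) x)).
Proof.
rewrite -(qstate_last n_gt0); elim: {-2}(2 * n - 1) (leqnn (2 * n - 1)) => [|i IHi] le_i.
  exact: orbit_refl.
apply: orbit_trans (IHi (ltnW le_i)) _.
rewrite iterS -dual_transformation_nseq ?lt_last_index //.
exact: (orbit_dual false (Sb :: _)).
Qed.

Lemma map_swap_ac_nseq k : map swap_ac (nseq k Sa) = nseq k Sc.
Proof. by rewrite map_nseq. Qed.

Lemma orbit_extend_nseq_Sc k x : x != Sc ->
  orbit (rcons (nseq k Sc) x) (rcons (nseq k Sc) Sb).
Proof.
have to1 i : i < 2 * n - 1 ->
    orbit (rcons (nseq k Sc) (qstate n i.+1)) (rcons (nseq k Sc) (qstate n 1)).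
  elim: i => [|i IHi] lt_i; first exact: orbit_refl.
  apply: orbit_trans (IHi (ltnW lt_i)).
  apply: orbit_trans (orbit_nseq_Sa _ _) _; apply: orbit_trans (orbit_swap_ac _) _.
  rewrite map_rcons map_swap_ac_nseq.
  rewrite (_ : swap_ac _ = qstate n i.+1); first exact: orbit_refl.
  (* From q_(i+2) the iteration climbs to a, drops to c, and climbs i+1 steps to q_(i+1), which (a
     c) fixes. *)
  have -> : 2 * n - 1 = i.+1 + (1 + (2 * n - 1 - i.+2)).
    by rewrite addnA addn1 subnKC.
  rewrite iterD [iter (1 + _) _ _]iterD iter_step_Sa // (iter_step (i := 0)) ?(ltnW lt_i) //.
  by rewrite add0n /= insubT //; apply: lt_last_index.
have [->|[[|i] le_i ->]] // := state_cases x => _; first exact: orbit_refl.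
apply: orbit_trans (to1 i le_i) _.
(* The last index of the chain gives the letter a, which (a b) turns into b while fixing c^k. *)
have [j def_j] : exists j, 2 * n - 1 = j.+1.
  by exists (2 * n - 1).-1; rewrite prednK ?last_index_gt0.
have := to1 j; rewrite -def_j leqnn qstate_last // => /(_ isT)/orbit_sym/orbit_trans; apply.
apply: orbit_trans (orbit_swap_ab _) _; rewrite map_rcons map_nseq; exact: orbit_refl.
Qed.

(** Under the letter 1 the states form a single cycle c, q_1, ..., q_(2n-2), a, b of length 2n+1. *)
Lemma state_iter (q : astate n) : exists i, q = iter i (step true) Sc.
Proof.
have [->|[i le_i ->]] := state_cases q; last by exists i; rewrite (iter_step (i := 0)).
exists (2 * n - 1).+1; rewrite iterS (iter_step (i := 0)) //.
by rewrite add0n qstate_last.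
Qed.

Lemma iter_cycle (q : astate n) : iter (2 + (2 * n - 1)) (step true) q = q.
Proof.
have [i ->] := state_iter q; rewrite -iterD addnC iterD; congr iter.
by rewrite iterD (iter_step (i := 0)) // add0n qstate_last.
Qed.

Lemma orbit_extend_Sb_nseq_Sc k x : x != Sc ->
  exists2 y, y != x &
    orbit (Sb :: rcons (nseq k Sc) x) (Sb :: rcons (nseq k Sc) y).
Proof.
(* The witness is the last letter of the image under e. *)
move=> x_neq; exists (swap_ac (iter (2 * n - 1) (step true) x)); last first.
  apply: orbit_trans (orbit_Sb_nseq_Sa _ _) _; apply: orbit_trans (orbit_swap_ac _) _.
  by rewrite /= map_rcons map_swap_ac_nseq; apply: orbit_refl.
have swapK : involutive swap_ac by case.
apply/eqP => /(congr1 swap_ac); rewrite swapK => def_r.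
(* By the cycle length, a fixed letter x would be reached from [swap_ac x] in two steps. *)
have := iter_cycle x; rewrite iterD {}def_r.
case: x x_neq => [| | |i] //= _.
(* For x = a, two steps from c lead to b if n = 1 and to q_2 otherwise; q_2 is not a because 2n-1 is
   odd. *)
- case: insubP => //= j lt0 ->; rewrite insubT //.
  have even_len : 2 * n - 2 = 2 * (n - 1) by rewrite mulnBr muln1.
  by move: lt0; rewrite even_len; case: (n - 1) => // m; rewrite mulnS.
- by case: (insub 0).
- case: insubP => //= j _ ->; case: insubP => //= j' _ def_j' [] /(congr1 val).
  by rewrite [val j']def_j' => /eqP; rewrite -addn2 -[X in _ == X]addn0 eqn_add2l.
Qed.

(** * Induction on the level *)

Lemma dual_transitive k : transitive_on_level (automaton_group Z) k.
Proof.
elim: k => [|[|k] IHk].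
- by move=> u v /size0nil-> /size0nil->; apply: orbit_refl.
(* Level 1 is separate, since the word [w1] below needs room for its letter b; here the cycle of D_1
   suffices. *)
- have to_c x : orbit [:: Sc] [:: x].
    have [i ->] := state_iter x; elim: i => [|i IHi]; first exact: orbit_refl.
    exact: orbit_trans IHi (orbit_dual true _).
  case=> [|x []] // [|y []] // _ _; exact: orbit_trans (orbit_sym (to_c x)) (to_c y).
- apply: (transitive_on_next_level dual_out_inj dual_bireversible dual_trans_surj
    (b := Sb) (c := Sc) (w0 := nseq k.+1 Sc) (w1 := Sb :: nseq k Sc)) => //.
  + by rewrite size_nseq.
  + by rewrite /= size_nseq.
  + exact: orbit_extend_nseq_Sc.
  + exact: orbit_extend_Sb_nseq_Sc.
Qed.

End AleshinType.

Theorem proposition1p8 :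
  (invertible (dual aleshin) /\
   forall k : nat, transitive_on_level (automaton_group (dual aleshin)) k) /\
  (forall n : nat, 1 <= n ->
   invertible (dual (aleshin_type n)) /\
   forall k : nat,
     transitive_on_level (automaton_group (dual (aleshin_type n))) k).
Proof.
have inv_aleshin : invertible (dual aleshin).
  by apply: out_inj_invertible; case=> -[] [].
split; last by move=> n n_gt0; split=> [|k]; [apply: dual_invertible | apply: dual_transitive].
split=> // k.
apply: (transitive_on_level_rename (Y' := dual (aleshin_type 1)) (f := abc_rename)) => //.
- by move=> x q; have [] := aleshin_rename q x.
- by move=> x q; have [] := aleshin_rename q x.
- exact: abc_rename_bij.
- exact: dual_transitive.
Qed.
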